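(* Let $f(x)\in\mathbb{Q}[x]$ be a non-constant polynomial. If $\deg f$ is odd, then $f$ satisfies WP. If $\deg f$ is even, then $f(\mathbb{Q})$ is a positive base if the leading coefficient of $f$ is positive, and a negative base if the leading coefficient of $f$ is negative.
   Context: For $X\subseteq\mathbb{Q}$ and a positive integer $N$, write $X_N:=\{x_1+\cdots+x_N : x_1,\dots,x_N\in X\}$. $X$ is called a base if $X_N=\mathbb{Q}$ for some $N\ge 1$; a positive base if for some $N\ge1$ and some $a\in\mathbb{Q}$, $X_N\supseteq (a,\infty)\cap\mathbb{Q}$; a negative base if for some $N\ge 1$ and some $b\in\mathbb{Q}$, $X_N\supseteq(-\infty,b)\cap\mathbb{Q}$. $f(\mathbb{Q})=\{f(a):a\in\mathbb{Q}\}$, and $f$ satisfies WP if $f(\mathbb{Q})$ is a base. *)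

(* Defs.v *)
From HB Require Import structures.
From mathcomp Require Import all_boot all_order all_algebra.
Set Implicit Arguments. Unset Strict Implicit. Unset Printing Implicit Defensive.
Import Order.TTheory GRing.Theory Num.Theory.
Local Open Scope ring_scope.

Definition sumset (X : rat -> Prop) (N : nat) (q : rat) : Prop :=
  exists s : seq rat, size s = N /\ (forall x, x \in s -> X x) /\ \sum_(x <- s) x = q.

Definition is_base (X : rat -> Prop) : Prop :=
  exists N : nat, (0 < N)%N /\ forall q : rat, sumset X N q.

Definition is_positive_base (X : rat -> Prop) : Prop :=
  exists N : nat, exists a : rat, (0 < N)%N /\ forall q : rat, a < q -> sumset X N q.

Definition is_negative_base (X : rat -> Prop) : Prop :=
  exists N : nat, exists b : rat, (0 < N)%N /\ forall q : rat, q < b -> sumset X N q.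

Definition poly_image (f : {poly rat}) (y : rat) : Prop := exists a : rat, f.[a] = y.

Definition WP (f : {poly rat}) : Prop := is_base (poly_image f).

(* Main.v *)
Require Import Defs.
From HB Require Import structures.
From mathcomp Require Import all_boot all_order all_algebra.
From mathcomp Require Import qpoly cauchyreals polyrcf.
From mathcomp Require Import zify ring lra.
Import Order.TTheory GRing.Theory Num.Theory.
Local Open Scope ring_scope.

(** Let [T] be a standard Gaussian variable, and let [heat s p] denote the
    polynomial [a |-> E p(a + sqrt(s) T)]. The operators [heat s] form an additive
    semigroup in [s]. If finitely many rational nodes [ts], counted with
    multiplicity, have the same average moments as [T] up to degree [deg f], then
    the sum of [f(y t0 + x1 t1 + ... + x4 t4)] over all [t0, ..., t4] in [ts] depends
    only on [r = y^2 + x1^2 + ... + x4^2] (this is Hausdorff's form of Hilbert's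
    identity). By the four squares theorem over the rationals, [y] can be any
    rational with [y^2 <= r]; as [0] and [1] are nodes, [f(y)] is one of the
    summands, so [M - f(y)] is a sum of a bounded number of values of [f], for a
    constant [M] and all [y] in a large interval. Iterated differences of [f] give an
    identity [sum_i f(x + c_i) - sum_j f(x + d_j) = alpha x + beta]; replacing each
    [- f(x + d_j)] by [M - f(x + d_j)] shows that bounded sums of values of [f] fill
    an interval, and adding one more value of [f] reaches every large rational.
    When the degree is odd, adding a very negative value of [f] reaches them all.

    The nodes come from the symmetric binomial distribution with [m^2] steps of size
    [1/m]: its moments differ from the Gaussian ones by [O(1/m^2)], whereas the
    nodes [i/d] carry a mass at least [1/(4m)], so that for large [m] the moments can
    be corrected exactly, by Lagrange interpolation at the points [i/d], while the
    weights stay positive. *)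

(** * Four squares over the rationals *)

(** Pigeonhole: for [i, j <= p./2] the residues [i^2] and [-1 - j^2] form two sets of [(p + 1)/2]
    elements each in a field of [p] elements, so the sets meet. *)
Lemma prime_dvd_two_squares_add1 (p : nat) : prime p -> odd p ->
  exists i j : nat, [/\ (i <= p./2)%N, (j <= p./2)%N & (p %| i ^ 2 + j ^ 2 + 1)%N].
Proof.
move=> pr_p odd_p; set h := p./2.
have p_gt1 := prime_gt1 pr_p.
have ph : p = h.*2.+1 by rewrite -[LHS]odd_double_half odd_p.
have zero_dvd (n : nat) : (n%:R == 0 :> 'F_p) = (p %| n)%N.
  by rewrite -(dvdn_pcharf (pchar_Fp pr_p)).
have sq_inj : injective (fun i : 'I_h.+1 => (i%:R ^+ 2 : 'F_p)).
  move=> i j /eqP; rewrite -subr_eq0 subr_sqr mulf_eq0 => eq_ij; apply: val_inj => /=.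
  have ltnh (k : 'I_h.+1) : (k <= h)%N by rewrite -ltnS.
  have [lei lej] := (ltnh i, ltnh j).
  case/orP: eq_ij; last first.
    rewrite -natrD zero_dvd => /dvdnP [[|k]]; first lia.
    by rewrite {1}ph mulSn; lia.
  wlog le_ij : i j lei lej / (j <= i)%N.
    move=> th; case: (leqP j i) => [|/ltnW] le; first exact: th.
    by rewrite -opprB oppr_eq0 => /(th _ _ lej lei le).
  rewrite -natrB // zero_dvd => /dvdnP [[|k]]; first lia.
  by rewrite {1}ph mulSn; lia.
pose A := [set (i%:R ^+ 2 : 'F_p) | i : 'I_h.+1].
pose B := [set (- 1 - i%:R ^+ 2 : 'F_p) | i : 'I_h.+1].
have cA : #|A| = h.+1 by rewrite card_imset // card_ord.
have cB : #|B| = h.+1.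
  by rewrite card_imset ?card_ord // => i j /addrI /oppr_inj /sq_inj.
have cF : (#|A :|: B| <= p)%N by rewrite -[X in (_ <= X)%N](card_Fp pr_p) max_card.
have : (0 < #|A :&: B|)%N by move: (cardsUI A B); rewrite cA cB; lia.
case/card_gt0P => x /setIP [/imsetP [i _ ->] /imsetP [j _ eq_ij]].
exists i, j; split; [exact: (ltn_ord i) | exact: (ltn_ord j) |].
by rewrite -zero_dvd !natrD !natrX eq_ij; apply/eqP; ring.
Qed.

Definition four_squares (q : rat) : Prop :=
  exists a b c d : rat, q = a ^+ 2 + b ^+ 2 + c ^+ 2 + d ^+ 2.

(** Euler's identity: the quaternion norm is multiplicative. *)
Lemma four_squaresM (x y : rat) :
  four_squares x -> four_squares y -> four_squares (x * y).
Proof.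
move=> [a [b [c [d ->]]]] [a' [b' [c' [d' ->]]]].
exists (a * a' + b * b' + c * c' + d * d'), (a * b' - b * a' + c * d' - d * c'),
  (a * c' - b * d' - c * a' + d * b'), (a * d' + b * c' - c * b' - d * a').
ring.
Qed.

Lemma four_squares_div (x y : rat) :
  four_squares x -> four_squares y -> four_squares (x / y).
Proof.
move=> fx fy; have [->|y0] := eqVneq y 0.
  by rewrite invr0 mulr0; exists 0, 0, 0, 0; ring.
have -> : x / y = x * y * (y^-1) ^+ 2 by field.
apply: four_squaresM; first exact: four_squaresM.
by exists y^-1, 0, 0, 0; ring.
Qed.

(* Over the rationals no descent is needed: [p = (i^2 + j^2 + 1) / m] with
   [m < p], and sums of four squares are closed under division. *)
Lemma four_squares_nat (n : nat) : four_squares n%:R.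
Proof.
elim/ltn_ind: n => n IHn.
case: n IHn => [|[|n]] IHn; first by exists 0, 0, 0, 0; ring.
  by exists 1, 0, 0, 0; ring.
have [pr|npr] := boolP (prime n.+2); last first.
  case/primePn: npr => // -[d /andP [d1 dn] /dvdnP [e eqe]].
  rewrite eqe natrM; apply: four_squaresM; apply: IHn => //.
  by move: eqe dn d1 => ->; nia.
set p := n.+2 in IHn pr *.
have [odd_p|even_p] := boolP (odd p); last first.
  have -> : p = 2%N by case: (even_prime pr) => // o; rewrite o in even_p.
  by exists 1, 1, 0, 0; ring.
have [i [j [lei lej /dvdnP [m eqm]]]] := prime_dvd_two_squares_add1 p pr odd_p.
have p0 : (0 < p)%N by [].
have lt_mp : (m < p)%N by nia.
have m0 : (0 < m)%N by case: m eqm {lt_mp} => //; lia.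
have -> : p%:R = (m%:R * p%:R) / m%:R :> rat.
  by rewrite mulrAC mulfV ?mul1r // pnatr_eq0 -lt0n.
apply: four_squares_div; last exact: IHn.
rewrite -natrM -eqm; exists i%:R, j%:R, 1, 0.
by rewrite !natrD !natrX; ring.
Qed.

Lemma four_squares_ge0 (q : rat) : 0 <= q -> four_squares q.
Proof.
move=> q0; rewrite -[q]divq_num_den.
have : 0 <= numq q by rewrite numq_ge0.
case: (numq q) => // n _.
have : 0 < denq q by exact: denq_gt0.
case: (denq q) => // m _.
by rewrite -!pmulrn; apply: four_squares_div; apply: four_squares_nat.
Qed.

(** * Moments of the binomial distribution *)

(** This is [2^n] times the mean of [g] at the endpoint of a symmetric walk of [n] steps of size
    1. *)
Definition walk (n : nat) (g : rat -> rat) : rat :=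
  \sum_(k < n.+1) 'C(n, k)%:R * g (k.*2%:R - n%:R).

Lemma eq_walk n (g h : rat -> rat) : g =1 h -> walk n g = walk n h.
Proof. by move=> gh; apply: eq_bigr => k _; rewrite gh. Qed.

Lemma walkD n (g h : rat -> rat) :
  walk n (fun x => g x + h x) = walk n g + walk n h.
Proof. by rewrite -big_split; apply: eq_bigr => k _; rewrite mulrDr. Qed.

Lemma walkZ n (c : rat) (g : rat -> rat) :
  walk n (fun x => c * g x) = c * walk n g.
Proof. by rewrite mulr_sumr; apply: eq_bigr => k _; rewrite mulrCA. Qed.

Lemma walkB n (g h : rat -> rat) :
  walk n (fun x => g x - h x) = walk n g - walk n h.
Proof. by rewrite -sumrB; apply: eq_bigr => k _; rewrite mulrBr. Qed.

Lemma walk_sum n (I : finType) (F : I -> rat -> rat) :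
  walk n (fun x => \sum_i F i x) = \sum_i walk n (F i).
Proof.
rewrite /walk exchange_big; apply: eq_bigr => k _.
by rewrite mulr_sumr.
Qed.

Lemma walk0 (g : rat -> rat) : walk 0 g = g 0.
Proof. by rewrite /walk big_ord_recl big_ord0 bin0 subrr mul1r addr0. Qed.

(** Pascal's rule: condition on one step of the walk. *)
Lemma walkS n (g : rat -> rat) :
  walk n.+1 g = walk n (fun x => g (x + 1)) + walk n (fun x => g (x - 1)).
Proof.
rewrite /walk big_ord_recl bin0 /=.
under eq_bigr => k _ do rewrite /bump /= add1n binS natrD mulrDl.
rewrite big_split /= addrA addrC; congr (_ + _).
  by apply: eq_bigr => k _; congr (_ * g _); rewrite doubleS -!natr1; ring.
rewrite [LHS](_ : _ = \sum_(k < n.+2) 'C(n, k)%:R * g (k.*2%:R - n.+1%:R)); last first.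
  by rewrite [RHS]big_ord_recl bin0 /=.
rewrite big_ord_recr /= bin_small // mul0r addr0.
by apply: eq_bigr => k _; congr (_ * g _); rewrite -natr1; ring.
Qed.

(* The discrete counterpart of Gaussian integration by parts
   [E (X g(X)) = E (g'(X))]. *)
Lemma walk_mulX n (g : rat -> rat) :
  walk n.+1 (fun x => x * g x) =
  n.+1%:R * (walk n (fun x => g (x + 1)) - walk n (fun x => g (x - 1))).
Proof.
elim: n g => [|n IHn] g.
  by rewrite walkS !walk0; ring.
pose h x := g (x + 1) + g (x - 1).
rewrite walkS (eq_walk _ _ (fun x => x * g (x + 1) + g (x + 1))); last first.
  by move=> x; ring.
rewrite [X in _ + X](eq_walk _ _ (fun x => x * g (x - 1) - g (x - 1))); last first.
  by move=> x; ring.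
rewrite walkD walkB.
transitivity (walk n.+1 (fun x => x * h x) +
    (walk n.+1 (fun x => g (x + 1)) - walk n.+1 (fun x => g (x - 1)))).
  rewrite (eq_walk _ (fun x => x * h x) (fun x => x * g (x + 1) + x * g (x - 1))).
    by rewrite walkD; ring.
  by move=> x; rewrite mulrDr.
(* After the induction hypothesis for [h], the two terms in which opposite shifts meet cancel. *)
rewrite IHn /h !walkD !walkS.
rewrite -[n.+2%:R]natr1.
have E a b : walk n (fun x => g (x + a + b)) = walk n (fun x => g (x + (a + b))).
  by apply: eq_walk => x; rewrite addrA.
by rewrite !E subrr addNr; ring.
Qed.

Fixpoint gauss_moment (j : nat) : rat :=
  match j with
  | 0 => 1
  | 1 => 0
  | j'.+2 => j'.+1%:R * gauss_moment j'
  end.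

Lemma gauss_moment_odd j : odd j -> gauss_moment j = 0.
Proof.
elim/ltn_ind: j => -[|[|j]] IHj //= oj.
by rewrite IHj ?mulr0 //; rewrite negbK in oj.
Qed.

(** A translation of the variable keeps the leading coefficient; if the degree is below [s], both
    sides are 0. *)
Lemma coef_comp_shift (R : idomainType) (p : {poly R}) (c : R) (s : nat) :
  (size p <= s.+1)%N -> (p \Po ('X - c%:P))`_s = p`_s.
Proof.
move=> sp; have sX : size ('X - c%:P) = 2 by exact: size_XsubC.
have [eqs|ns] := eqVneq (size p) s.+1; last first.
  have lt_ps : (size p <= s)%N by rewrite -ltnS ltn_neqAle ns.
  by rewrite !nth_default ?size_comp_poly2.
have := lead_coef_comp p (q := 'X - c%:P); rewrite sX => /(_ isT).
by rewrite lead_coefXsubC expr1n mulr1 /lead_coef size_comp_poly2 // eqs.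
Qed.

(** Apply [walk_mulX] to [x^j] and expand [(x+1)^j - (x-1)^j]; only odd [i] contribute. *)
Lemma walk_moment_rec n j :
  walk n.+1 (fun x => x ^+ j.+1) = n.+1%:R *
    \sum_(i < j.+1) ('C(j, i)%:R * (1 - (-1) ^+ i)) * walk n (fun x => x ^+ (j - i)).
Proof.
rewrite (eq_walk _ _ (fun x => x * x ^+ j)); last by move=> x; rewrite exprS.
rewrite walk_mulX -walkB; congr (_ * _).
under [RHS]eq_bigr => i _ do rewrite -walkZ.
rewrite -walk_sum; apply: eq_walk => x.
rewrite !exprDn -sumrB; apply: eq_bigr => i _.
by rewrite expr1n mulr1 -mulrnBl -mulr_natl; ring.
Qed.

(** A central limit theorem for moments: the [j]-th moment after [n] steps is a polynomial in [n]
    whose coefficient at [j./2] is the Gaussian moment. It follows by strong induction from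
    [walk_moment_rec]. *)
Lemma walk_moment_poly j : exists p : {poly rat},
  [/\ forall n : nat, walk n (fun x => x ^+ j) = 2 ^+ n * p.[n%:R],
      (size p <= j./2.+1)%N, odd j -> p = 0 & p`_(j./2) = gauss_moment j].
Proof.
elim/ltn_ind: j => -[|j] IHj.
  exists 1; split=> //; rewrite ?size_poly1 ?coef1 // => n.
  rewrite hornerC mulr1 /walk.
  have := exprDn (1 : rat) 1 n; rewrite -[1 + 1]/(2 : rat) => ->.
  by apply: eq_bigr => k _; rewrite expr0 !expr1n mulr1.
have [|P HP] := @fin_all_exists 'I_j.+1 _ (fun (i : 'I_j.+1) p =>
  [/\ forall n : nat, walk n (fun x => x ^+ i) = 2 ^+ n * p.[n%:R],
      (size p <= i./2.+1)%N, odd i -> p = 0 & p`_(i./2) = gauss_moment i]).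
- by move=> i; apply: IHj.
pose c i : rat := 'C(j, i)%:R * (1 - (-1) ^+ i) / 2.
(* The recursion passes from [n.+1] to [n] steps, hence the shift by 1; its factor [n.+1] becomes
   the ['X] in ['X * Q]. *)
pose Q := \sum_(i < j.+1) c i *: (P (rev_ord i) \Po ('X - 1%:P)).
have c0 i : ~~ odd i -> c i = 0.
  by move=> ei; rewrite /c -signr_odd (negbTE ei) expr0 subrr mulr0 mul0r.
have revE (i : 'I_j.+1) : rev_ord i = (j - i)%N :> nat by rewrite /= subSS.
have szP (i : 'I_j.+1) : (size (P (rev_ord i) \Po ('X - 1%:P)) <= (j - i)./2.+1)%N.
  rewrite size_comp_poly2 ?size_XsubC //.
  by have [_ + _ _] := HP (rev_ord i); rewrite revE.
exists ('X * Q); split.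
- case=> [|n].
    by rewrite walk0 exprS mul0r hornerM hornerX mul0r mulr0.
  rewrite walk_moment_rec hornerM hornerX exprS horner_sum.
  rewrite !mulr_sumr; apply: eq_bigr => i _.
  have [+ _ _ _] := HP (rev_ord i); rewrite revE => ->.
  rewrite hornerZ horner_comp hornerXsubC.
  have -> : n.+1%:R - 1 = n%:R :> rat by rewrite -natr1; ring.
  by rewrite /c; field.
- suff szQ : (size Q <= j.+1./2)%N.
    by rewrite (leq_trans (size_polyMleq _ _)) // size_polyX.
  apply: leq_trans (size_sum _ _ _) _.
  apply/bigmax_leqP => i _; have [oi|ei] := boolP (odd i); last first.
    by rewrite c0 // scale0r size_poly0.
  apply: leq_trans (size_scale_leq _ _) (leq_trans (szP i) _).
  by have := ltn_ord i; lia.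
- move=> oj; rewrite /Q big1 ?mulr0 // => i _.
  have [oi|ei] := boolP (odd i); last by rewrite c0 ?scale0r.
  have [_ _ + _] := HP (rev_ord i); rewrite revE => ->.
    by rewrite comp_poly0 scaler0.
  by have := ltn_ord i; lia.
- have [oj|ej] := boolP (odd j.+1).
    rewrite gauss_moment_odd // (_ : Q = 0) ?mulr0 ?coef0 // /Q big1 // => i _.
    have [oi|ei] := boolP (odd i); last by rewrite c0 ?scale0r.
    have [_ _ + _] := HP (rev_ord i); rewrite revE => ->.
      by rewrite comp_poly0 scaler0.
    by have := ltn_ord i; lia.
  have j0 : (0 < j)%N by case: (j) ej.
  have -> : gauss_moment j.+1 = j%:R * gauss_moment j.-1 by case: (j) j0.
  have -> : (j.+1)./2 = (j.-1)./2.+1 by lia.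
  rewrite coefXM /= /Q coef_sum.
  (* Only [i = 1], with [c 1 = j], reaches the top coefficient; larger odd [i] give a smaller
     degree. *)
  rewrite (bigD1 (Ordinal (j0 : 1 < j.+1)%N)) //= big1 ?addr0 => [|i].
    set i1 := Ordinal _; rewrite coefZ.
    have [_ s1 _ l1] := HP (rev_ord i1).
    have e1 : rev_ord i1 = j.-1 :> nat by rewrite revE /= subn1.
    rewrite coef_comp_shift; last by rewrite e1 in s1.
    by rewrite e1 in l1; rewrite l1 /c bin1 expr1; field.
  rewrite -val_eqE /= => i1; rewrite coefZ.
  have [oi|ei] := boolP (odd i); last by rewrite c0 ?mul0r.
  rewrite nth_default ?mulr0 // (leq_trans (szP i)) //.
  by have := ltn_ord i; lia.
Qed.

(** * Rational nodes with Gaussian moments *)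

(** With [m^2] steps of size [1/m] the top term of the moment polynomial is exactly the Gaussian
    moment, and every lower term carries a factor of at most [1/m^2]. *)
Lemma walk_moment_approx j : exists C : rat, 0 <= C /\ forall m : nat, (0 < m)%N ->
  `|walk (m ^ 2) (fun x => (x / m%:R) ^+ j) / 2 ^+ (m ^ 2) - gauss_moment j|
    <= C / m%:R ^+ 2.
Proof.
have [p [Hp sp op lp]] := walk_moment_poly j.
exists (\sum_(i < j./2) `|p`_i|); split=> [|m m0]; first exact: sumr_ge0.
have m0' : (m%:R : rat) != 0 by rewrite pnatr_eq0 -lt0n.
have -> : walk (m ^ 2) (fun x => (x / m%:R) ^+ j) / 2 ^+ (m ^ 2)
    = p.[m%:R ^+ 2] / m%:R ^+ j.
  rewrite (eq_walk _ _ (fun x => (m%:R ^+ j)^-1 * x ^+ j)); last first.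
    by move=> x; rewrite expr_div_n mulrC.
  rewrite walkZ Hp natrX; field.
  by rewrite !expf_neq0.
have [oj|ej] := boolP (odd j).
  rewrite op // horner0 gauss_moment_odd // mul0r subrr normr0.
  by rewrite divr_ge0 ?sumr_ge0 ?exprn_ge0.
set s := j./2 in sp lp *; have js : j = (2 * s)%N by rewrite /s; lia.
rewrite [in _ ^+ j]js exprM -lp; set N := m%:R ^+ 2.
have N1 : 1 <= N by rewrite /N -natrX ler1n expn_gt0 m0.
have N0 : 0 < N by lra.
have Ns0 : 0 < N ^+ s by apply: exprn_gt0.
have NsU : N ^+ s != 0 by rewrite gt_eqF.
rewrite (horner_coef_wide _ sp) big_ord_recr /= mulrDl (mulfK NsU).
rewrite addrK !mulr_suml; apply: le_trans (ler_norm_sum _ _ _) _.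
apply: ler_sum => i _; rewrite -mulrA normrM ler_wpM2l //.
rewrite ger0_norm; last by rewrite divr_ge0 ?(ltW Ns0) // exprn_ge0 // ltW.
rewrite ler_pdivrMr // ler_pdivlMl // -exprS.
by rewrite ler_weXn2l // ltn_ord.
Qed.

(** The mean of [p] at a standard Gaussian variable, provided that [size p <= N]. *)
Definition gauss (N : nat) (p : {poly rat}) : rat :=
  \sum_(j < N) p`_j * gauss_moment j.

Lemma walk_gauss_approx N (p : {poly rat}) : (size p <= N)%N ->
  exists C : rat, 0 <= C /\ forall m : nat, (0 < m)%N ->
  `|walk (m ^ 2) (fun x => p.[x / m%:R]) / 2 ^+ (m ^ 2) - gauss N p|
    <= C / m%:R ^+ 2.
Proof.
move=> sp; have [|C HC] := @fin_all_exists 'I_N _ (fun (j : 'I_N) (C : rat) =>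
  0 <= C /\ forall m : nat, (0 < m)%N ->
  `|walk (m ^ 2) (fun x => (x / m%:R) ^+ j) / 2 ^+ (m ^ 2) - gauss_moment j|
    <= C / m%:R ^+ 2).
  by move=> j; apply: walk_moment_approx.
exists (\sum_(j < N) `|p`_j| * C j); split=> [|m m0].
  by apply: sumr_ge0 => j _; apply: mulr_ge0 => //; case: (HC j).
rewrite (eq_walk _ _ (fun x => \sum_(j < N) p`_j * (x / m%:R) ^+ j)); last first.
  by move=> x; apply: horner_coef_wide.
rewrite walk_sum mulr_suml -sumrB mulr_suml.
apply: le_trans (ler_norm_sum _ _ _) _; apply: ler_sum => j _.
rewrite walkZ -mulrA -mulrBr normrM -mulrA ler_wpM2l //.
by case: (HC j) => _; apply.
Qed.

(** The bound [4^l / (2 sqrt l)], squared to stay in [nat]. The induction rests on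
    [4 L (L + 1) <= (2 L + 1)^2]. *)
Lemma central_bin_lower l : (0 < l)%N -> (16 ^ l <= 4 * l * 'C(2 * l, l) ^ 2)%N.
Proof.
case: l => // l _; elim: l => [|l IHl]; first by [].
set L := l.+1 in IHl *.
have e1 : (L.+1 * 'C(2 * L.+1, L.+1) = (2 * L + 2) * 'C((2 * L).+1, L))%N.
  by rewrite -mul_bin_diag; congr (_ * 'C(_, _))%N; lia.
have e2 : (L.+1 * 'C((2 * L).+1, L) = (2 * L).+1 * 'C(2 * L, L))%N.
  by rewrite (mul_bin_down (2 * L).+1 L) /=; congr (_ * _)%N; lia.
have e3 : (L.+1 * 'C(2 * L.+1, L.+1) = 2 * (2 * L).+1 * 'C(2 * L, L))%N by nia.
rewrite -(leq_pmul2l (_ : 0 < L.+1 ^ 2)%N) ?expn_gt0 //.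
rewrite (_ : L.+1 ^ 2 * (4 * L.+1 * 'C(2 * L.+1, L.+1) ^ 2) =
  4 * L.+1 * (L.+1 * 'C(2 * L.+1, L.+1)) ^ 2)%N; last by ring.
rewrite e3 expnS; set c := 'C(2 * L, L) in IHl *.
apply: (@leq_trans (L.+1 ^ 2 * (16 * (4 * L * c ^ 2)))).
  by rewrite !leq_pmul2l ?expn_gt0.
rewrite (_ : L.+1 ^ 2 * (16 * (4 * L * c ^ 2)) = L.+1 * (16 * c ^ 2) * (4 * L * L.+1))%N; last by ring.
rewrite (_ : 4 * L.+1 * (2 * (2 * L).+1 * c) ^ 2 = L.+1 * (16 * c ^ 2) * (2 * L).+1 ^ 2)%N; last by ring.
by rewrite leq_mul2l; apply/orP; right; nia.
Qed.

(** Consecutive coefficients have ratio [(l - i)/(l + i + 1)], which yields the factor [1 - i^2/l]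
    by induction. Truncated subtraction makes the case [i^2 > l] trivial. *)
Lemma bin_offset_lower l i : (i <= l)%N ->
  ((l - i ^ 2) * 'C(2 * l, l) <= l * 'C(2 * l, l + i))%N.
Proof.
elim: i => [|i IHi] il; first by rewrite subn0 addn0.
have := IHi (ltnW il); set c := 'C(2 * l, l); set a := 'C(2 * l, l + i).
have := mul_bin_left (2 * l) (l + i); rewrite -addnS -/a.
set b := 'C(2 * l, _); rewrite (_ : 2 * l - (l + i) = l - i)%N; last by lia.
move=> e IH.
have [le|gt] := leqP (i.+1 ^ 2) l; last first.
  by rewrite (_ : l - i.+1 ^ 2 = 0)%N // -?subn_eq0; move: gt => /ltnW; rewrite -subn_eq0 => /eqP.
have pos : (0 < l + i.+1)%N by rewrite addnS.
rewrite -(leq_pmul2l pos) (mulnCA (l + i.+1) l) e (mulnCA l); apply: leq_trans (leq_mul (leqnn (l - i)) IH).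
rewrite !mulnA leq_mul2r; apply/orP; right.
have [r er] : exists r, l = (i.+1 ^ 2 + r)%N by exists (l - i.+1 ^ 2)%N; lia.
rewrite (_ : l - i.+1 ^ 2 = r)%N; last by lia.
rewrite (_ : l - i ^ 2 = r + 2 * i + 1)%N; last by nia.
rewrite (_ : l - i = r + i ^ 2 + i + 1)%N; last by nia.
by rewrite er; nia.
Qed.

(** Multiplied by a common denominator [D], positive weights become multiplicities in a list. *)
Lemma rational_weights (s : seq (rat * rat)) : (forall w, w \in s -> 0 < w.1) ->
  exists (D : nat) (ts : seq rat),
  [/\ (0 < D)%N,
      forall g : rat -> rat,
        \sum_(t <- ts) g t = D%:R * \sum_(w <- s) w.1 * g w.2 &
      forall w, w \in s -> w.2 \in ts].
Proof.
elim: s => [|[w v] s IHs] spos.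
  by exists 1%N, [::]; split=> // g; rewrite !big_nil mulr0.
have [|D [ts [D0 Hts mts]]] := IHs.
  by move=> u us; apply: spos; rewrite inE us orbT.
have w0 : 0 < w by apply: (spos (w, v)); rewrite inE eqxx.
have [a [b [a0 b0 ew]]] : exists a b : nat, [/\ (0 < a)%N, (0 < b)%N & w = a%:R / b%:R].
  exists `|numq w|%N, `|denq w|%N; rewrite !absz_gt0 denq_neq0 numq_eq0 gt_eqF //.
  by split=> //; rewrite !natr_absz !ger0_norm ?numq_ge0 ?denq_ge0 ?divq_num_den ?(ltW w0).
exists (D * b)%N, (nseq (D * a) v ++ flatten (nseq b ts)); split.
- by rewrite muln_gt0 D0.
- move=> g; rewrite big_cat big_nseq /= iter_addr_0 big_cons /= ew.
  have -> : \sum_(t <- flatten (nseq b ts)) g t = b%:R * \sum_(t <- ts) g t.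
    elim: b {ew b0} => [|b IHb]; first by rewrite big_nil mul0r.
    by rewrite /= big_cat IHb -natr1 /=; ring.
  rewrite Hts -mulr_natl !natrM; field.
  by rewrite pnatr_eq0 -lt0n.
- move=> u; rewrite inE mem_cat mem_nseq muln_gt0 D0 a0 /=.
  case/orP => [/eqP -> /=|us]; first by rewrite eqxx.
  by case: b b0 {ew} => // b _; rewrite /= mem_cat (mts _ us) orbT.
Qed.

(** The central weight is at least [1/(2m)], and an offset with [i^2 <= l/2] costs at most a factor
    2. *)
Lemma central_weight_lower m l i : (0 < m)%N -> (m ^ 2 = 2 * l)%N -> (2 * i ^ 2 <= l)%N ->
  1 / (4 * m%:R) <= 'C(m ^ 2, l + i)%:R / 2 ^+ (m ^ 2) :> rat.
Proof.
move=> m0 eml il.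
have l0 : (0 < l)%N by nia.
have le_il : (i <= l)%N by nia.
have off := bin_offset_lower l i le_il.
have cen := central_bin_lower l l0.
rewrite -eml in off cen.
set c := 'C(m ^ 2, l) in off cen; set b := 'C(m ^ 2, l + i) in off *.
have cb : (c <= 2 * b)%N.
  rewrite -(leq_pmul2l l0); apply: leq_trans (_ : 2 * ((l - i ^ 2) * c) <= _)%N; last by nia.
  by rewrite mulnA leq_mul2r; apply/orP; right; lia.
have e2 : (2 ^ (m ^ 2) = 4 ^ l)%N by rewrite eml expnM.
have k : (4 ^ l <= 2 * m * c)%N.
  rewrite -(leq_exp2r _ _ (isT : 0 < 2)%N) -expnM mulnC expnM.
  apply: leq_trans cen _.
  rewrite !expnMn (_ : 4 * l = 2 * m ^ 2)%N; last by lia.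
  by rewrite leq_mul2r; apply/orP; right; lia.
rewrite ler_pdivrMr ?mulr_gt0 ?ltr0n // mulrAC ler_pdivlMr ?exprn_gt0 //.
rewrite mul1r -!natrX -!natrM ler_nat e2; nia.
Qed.

Definition gaussian_nodes (d : nat) (ts : seq rat) : Prop :=
  forall j, (j <= d)%N -> \sum_(t <- ts) t ^+ j = (size ts)%:R * gauss_moment j.

Lemma gauss_quadrature d : (0 < d)%N -> exists ts : seq rat,
  [/\ 0 \in ts, 1 \in ts & gaussian_nodes d ts].
Proof.
move=> d0; pose x (i : nat) : rat := i%:R / d%:R.
have dn0 : (d%:R : rat) != 0 by rewrite pnatr_eq0 -lt0n.
have x_inj : injective x.
  move=> i j /(congr1 (fun z => z * d%:R)); rewrite !divfK // => /eqP.
  by rewrite eqr_nat => /eqP.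
pose ell (i : 'I_d.+1) : {poly rat} := tnth (d.+1.-lagrange x) i.
have sz_ell i : (size (ell i) <= d.+1)%N by rewrite size_lagrange_.
have interp j : (j <= d)%N -> 'X^j = \sum_(i < d.+1) (x i ^+ j)%:P * ell i.
  move=> jd; rewrite [LHS](lagrange_gen (ltn0Sn d) x_inj) ?size_polyXn //.
  by apply: eq_bigr => i _; rewrite hornerXn.
have [|Cs HC] := @fin_all_exists 'I_d.+1 _ (fun i (C : rat) =>
  0 <= C /\ forall m : nat, (0 < m)%N ->
  `|walk (m ^ 2) (fun y => (ell i).[y / m%:R]) / 2 ^+ (m ^ 2) - gauss d.+1 (ell i)|
    <= C / m%:R ^+ 2).
  by move=> i; apply: walk_gauss_approx.
pose C := \sum_i Cs i.
have C0 : 0 <= C by apply: sumr_ge0 => i _; case: (HC i).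
(* Then [4 C < 2 q <= m], so the total correction [C/m^2] stays below the weight [1/(4m)]. *)
pose q := (Num.bound (2 * C)).+1.
have qC : 2 * C < q%:R.
  by rewrite /q -natr1; have := archi_boundP (mulr_ge0 (ler0n _ 2) C0); lra.
(* As [m] is even, [l = n/2] is the central index; as [d] divides [m/2], the node [i/d] is the walk
   position of index [l + i q]. *)
pose m := (2 * d * q)%N; pose l := (2 * d ^ 2 * q ^ 2)%N; pose n := (m ^ 2)%N.
have nl : n = (2 * l)%N by rewrite /n /m /l; ring.
have m0 : (0 < m)%N by rewrite !muln_gt0 d0.
have mn0 : (m%:R : rat) != 0 by rewrite pnatr_eq0 -lt0n.
(* Adding mass [e i] at [i/d] replaces the walk mean of [ell i] by its Gaussian mean; by
   interpolation all moments up to [d] become exact. *)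
pose e i := gauss d.+1 (ell i) - walk n (fun y => (ell i).[y / m%:R]) / 2 ^+ n.
have e_le : \sum_i `|e i| <= C / m%:R ^+ 2.
  rewrite mulr_suml; apply: ler_sum => i _; rewrite distrC.
  by case: (HC i) => _; apply.
pose v (k : nat) : rat := (k.*2%:R - n%:R) / m%:R.
pose idx (i : nat) := (l + i * q)%N.
have v_idx i : v (idx i) = x i.
  rewrite /v /idx nl /x /m -mul2n !natrM !natrD !natrM; field.
  by rewrite dn0 pnatr_eq0.
have idx_lt (i : 'I_d.+1) : (idx i < n.+1)%N.
  rewrite ltnS nl /idx mul2n -addnn leq_add2l /l.
  rewrite (_ : 2 * d ^ 2 * q ^ 2 = d * q * (2 * d * q))%N; last by ring.
  by rewrite -[X in (X <= _)%N]muln1 leq_mul ?muln_gt0 ?d0 // leq_mul2r -ltnS ltn_ord orbT.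
pose w (k : nat) : rat := 'C(n, k)%:R / 2 ^+ n.
pose w' (k : nat) : rat := w k + \sum_(i < d.+1 | idx i == k) e i.
have w'_gt0 (k : 'I_n.+1) : 0 < w' k.
  have [/existsP [i /eqP ik]|no] := boolP [exists i : 'I_d.+1, idx i == k]; last first.
    rewrite /w' big_pred0 ?addr0; last first.
      by move=> i; apply/negbTE; apply: contra no => ik; apply/existsP; exists i.
    by rewrite /w divr_gt0 ?exprn_gt0 // ltr0n bin_gt0 -ltnS ltn_ord.
  have wk : 1 / (4 * m%:R) <= w k.
    rewrite -ik; apply: central_weight_lower => //.
    have := ltn_ord i; rewrite ltnS => lid; rewrite /l expnMn mulnA leq_mul2r.
    by apply/orP; right; rewrite leq_mul2l leq_sqr lid.
  have ek : `|\sum_(i < d.+1 | idx i == k) e i| <= C / m%:R ^+ 2.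
    apply: le_trans e_le; apply: le_trans (ler_norm_sum _ _ _) _.
    by rewrite [leRHS](bigID (fun i : 'I_d.+1 => idx i == k)) /= lerDl sumr_ge0.
  suff : C / m%:R ^+ 2 < 1 / (4 * m%:R).
    by move: ek; rewrite /w' ler_norml => /andP []; lra.
  have mr0 : 0 < m%:R :> rat by rewrite ltr0n.
  rewrite ltr_pdivrMr ?exprn_gt0 //.
  rewrite (_ : 1 / (4 * m%:R) * m%:R ^+ 2 = m%:R / 4); last by field.
  have : (2 * q%:R : rat) <= m%:R.
    by rewrite -natrM ler_nat /m leq_mul2r -[X in (X <= _)%N]muln1 leq_mul2l d0 orbT.
  by lra.
have sum_w' (g : rat -> rat) : \sum_(k < n.+1) w' k * g (v k) =
    walk n (fun y => g (y / m%:R)) / 2 ^+ n + \sum_(i < d.+1) e i * g (x i).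
  under eq_bigr => k _ do rewrite mulrDl.
  rewrite big_split; congr (_ + _) => /=.
    by rewrite mulr_suml; apply: eq_bigr => k _; rewrite /w mulrAC.
  under eq_bigr => k _ do rewrite mulr_suml.
  rewrite (exchange_big_dep predT) //=; apply: eq_bigr => i _.
  by rewrite (big_pred1 (Ordinal (idx_lt i))) /= ?v_idx.
have moments j : (j <= d)%N -> \sum_(k < n.+1) w' k * v k ^+ j = gauss_moment j.
  move=> jd; rewrite (sum_w' (fun y => y ^+ j)).
  have -> : walk n (fun y => (y / m%:R) ^+ j) =
      \sum_(i < d.+1) x i ^+ j * walk n (fun y => (ell i).[y / m%:R]).
    under [RHS]eq_bigr => i _ do rewrite -walkZ.
    rewrite -walk_sum; apply: eq_walk => y.
    rewrite -hornerXn interp // horner_sum; apply: eq_bigr => i _.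
    by rewrite hornerCM.
  rewrite mulr_suml -big_split /=.
  transitivity (\sum_(i < d.+1) x i ^+ j * gauss d.+1 (ell i)).
    by apply: eq_bigr => i _; rewrite /e; ring.
  transitivity (gauss d.+1 'X^j); last first.
    rewrite /gauss (bigD1 (Ordinal (jd : j < d.+1)%N)) //= coefXn eqxx mul1r big1 ?addr0 //.
    by move=> k; rewrite -val_eqE coefXn /= => /negbTE ->; rewrite mul0r.
  rewrite interp // /gauss; under [RHS]eq_bigr => k _ do rewrite coef_sum mulr_suml.
  rewrite exchange_big; apply: eq_bigr => i _; rewrite mulr_sumr.
  by apply: eq_bigr => k _; rewrite coefCM mulrA.
have [|D [ts [D0 Hts mts]]] := rational_weights [seq (w' k, v k) | k : 'I_n.+1].
  by move=> u /mapP [k _ ->]; apply: w'_gt0.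
have sum_ts (g : rat -> rat) : \sum_(t <- ts) g t = D%:R * \sum_(k < n.+1) w' k * g (v k).
  by rewrite Hts big_map big_enum.
have xts (i : 'I_d.+1) : x i \in ts.
  rewrite -v_idx; apply: (mts (w' (idx i), v (idx i))).
  by apply/mapP; exists (Ordinal (idx_lt i)); rewrite ?mem_enum.
exists ts; split.
- by have := xts ord0; rewrite /x mul0r.
- by have := xts ord_max; rewrite /x divff.
- move=> j jd; rewrite (sum_ts (fun t => t ^+ j)) moments //; congr (_ * _).
  have := sum_ts (fun t => t ^+ 0); rewrite moments // mulr1 => <-.
  by rewrite big_const_seq count_predT iter_addr_0.
Qed.

(** * The heat semigroup *)

(** The exponential series of [s/2] times the second derivative, cut after [n] terms; nothing is
    lost when [size p <= n]. *)
Definition heat (n : nat) (s : rat) (p : {poly rat}) : {poly rat} :=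
  \sum_(j < n) (s ^+ j / (2 ^+ j * j`!%:R)) *: p^`(j.*2).

Lemma size_derivn (R : nzRingType) (p : {poly R}) k : (size p^`(k) <= size p - k)%N.
Proof.
elim: k => [|k IHk]; first by rewrite subn0.
rewrite derivnS; have [->|p0] := eqVneq (p^`(k)) 0; first by rewrite linear0 size_poly0.
by have := lt_size_deriv p0; lia.
Qed.

Lemma size_heat n s (p : {poly rat}) : (size (heat n s p) <= size p)%N.
Proof.
apply: leq_trans (size_sum _ _ _) _; apply/bigmax_leqP => j _.
apply: leq_trans (size_scale_leq _ _) (leq_trans (size_derivn _ _ _) _).
exact: leq_subr.
Qed.

Lemma heat0 n (p : {poly rat}) : (0 < n)%N -> heat n 0 p = p.
Proof.
case: n => // n _; rewrite /heat big_ord_recl big1 ?addr0.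
  by rewrite expr0 fact0 mul1r invr1 scale1r.
by move=> i _; rewrite exprS !mul0r scale0r.
Qed.

(** Regrouping by [l = i + j], as in a Cauchy product of truncated series. *)
Lemma sum_triangle (V : nmodType) n (F : nat -> nat -> V) :
  (forall i j, (n <= i + j)%N -> F i j = 0) ->
  \sum_(i < n) \sum_(j < n) F i j = \sum_(l < n) \sum_(i < l.+1) F i (l - i)%N.
Proof.
move=> F0.
have E (i : 'I_n) : \sum_(j < n) F i j = \sum_(l < n | (i <= l)%N) F i (l - i)%N.
  transitivity (\sum_(i <= l < n) F i (l - i)%N); last first.
    by rewrite big_geq_mkord.
  rewrite -[X in \sum_(X <= _ < _) _]add0n big_addn big_mkord.
  rewrite -!(big_mkord xpredT (F i)).
  rewrite (@big_cat_nat _ _ _ (n - i)) ?leq_subr //= [X in _ + X]big_nat_cond.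
  rewrite [X in _ + X]big1 ?addr0.
    by rewrite big_mkord; apply: eq_bigr => j _; rewrite addnK.
  by move=> j /andP [/andP [nj _] _]; apply: F0; lia.
under eq_bigr => i _ do rewrite E.
rewrite (exchange_big_dep predT) //=; apply: eq_bigr => l _.
rewrite (big_ord_widen_cond n xpredT (fun i => F i (l - i)%N)) //=.
Qed.

(** The exponential law: the binomial theorem collects the terms with [i + j = l], and those with
    [i + j >= n] differentiate [p] to 0. *)
Lemma heatD n s t (p : {poly rat}) : (size p <= n)%N ->
  heat n s (heat n t p) = heat n (s + t) p.
Proof.
move=> pn; rewrite /heat.
pose F i j : {poly rat} := (s ^+ i / (2 ^+ i * i`!%:R) * (t ^+ j / (2 ^+ j * j`!%:R)))
  *: p^`((i + j).*2).
transitivity (\sum_(i < n) \sum_(j < n) F i j).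
  apply: eq_bigr => i _; rewrite linear_sum scaler_sumr; apply: eq_bigr => j _ /=.
  by rewrite derivnZ scalerA /derivn -iterD -doubleD.
rewrite (@sum_triangle _ n F) => [|i j ij]; last first.
  by rewrite /F derivn_poly0 ?scaler0 //; lia.
apply: eq_bigr => l _; rewrite (eq_bigr (fun i : 'I_l.+1 =>
  (s ^+ i / (2 ^+ i * i`!%:R) * (t ^+ (l - i) / (2 ^+ (l - i) * (l - i)`!%:R))) *: p^`(l.*2))).
  rewrite -scaler_suml; congr (_ *: _).
  rewrite addrC exprDn mulr_suml; apply: eq_bigr => i _.
  have il : (i <= l)%N by rewrite -ltnS ltn_ord.
  have := bin_fact il; move/(congr1 (fun k => k%:R : rat)); rewrite !natrM => <-.
  rewrite -mulr_natl -[in 2 ^+ l](subnK il) exprD.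
  have f0 k : (k`!%:R : rat) != 0 by rewrite pnatr_eq0 -lt0n fact_gt0.
  have b0 : ('C(l, i)%:R : rat) != 0 by rewrite pnatr_eq0 -lt0n bin_gt0.
  field.
  by rewrite !f0 b0 !expf_neq0.
by move=> i _; rewrite /F subnKC // -ltnS ltn_ord.
Qed.

Lemma gauss_moment_even i :
  gauss_moment i.*2 * (2 ^+ i * i`!%:R) = (i.*2)`!%:R.
Proof.
elim: i => [|i IHi]; first by rewrite !mul1r.
rewrite doubleS [gauss_moment _]/= !factS !natrM -IHi exprS -!natr1 -mul2n natrM.
ring.
Qed.

(** Expand [p] at [a] by Taylor's formula: odd moments vanish, and the even ones [(2j)!/(2^j j!)]
    turn Taylor coefficients into those of [heat]. *)
Lemma sum_gaussian_nodes (d : nat) (ts : seq rat) (p : {poly rat}) (a b : rat) :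
  gaussian_nodes d ts -> (size p <= d.+1)%N ->
  \sum_(t <- ts) p.[a + b * t] = (size ts)%:R * (heat d.+1 (b ^+ 2) p).[a].
Proof.
move=> Hts sp.
transitivity (\sum_(j < d.+1) (p^`N(j).[a] * b ^+ j) * \sum_(t <- ts) t ^+ j).
  under [RHS]eq_bigr => j _ do rewrite mulr_sumr.
  rewrite exchange_big; apply: eq_bigr => t _.
  rewrite (nderiv_taylor_wide (mulrC _ _) sp); apply: eq_bigr => j _.
  by rewrite exprMn mulrA.
under eq_bigr => j _ do rewrite (Hts _ (leq_ord j)) mulrCA.
rewrite -mulr_sumr; congr (_ * _).
pose G j := p^`N(j).[a] * b ^+ j * gauss_moment j.
have G0 j : (d < j)%N -> G j = 0.
  move=> dj; rewrite /G (_ : p^`N(j) = 0) ?horner0 ?mul0r //.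
  apply/polyP => k; rewrite coef_nderivn coef0 nth_default ?mul0rn //.
  exact: leq_trans sp (leq_trans dj (leq_addr _ _)).
(* Odd indices and indices above [d] contribute 0, so the sum may run over doubled indices. *)
transitivity (\sum_(j < d.+1) G j.*2); last first.
  rewrite /heat horner_sum; apply: eq_bigr => j _; rewrite /G hornerZ nderivn_def hornerMn.
  have := gauss_moment_even j => e.
  have f0 : (2 ^+ j * j`!%:R : rat) != 0.
    by rewrite mulf_neq0 ?expf_neq0 // pnatr_eq0 -lt0n fact_gt0.
  rewrite -[_.[a] *+ _]mulr_natl -e -exprM mul2n; field.
  by move: f0; rewrite mulf_eq0 negb_or => /andP [-> ->].
rewrite -!(big_mkord xpredT (fun j => G j)) -(big_mkord xpredT (fun j => G j.*2)).
have dbl n : \sum_(0 <= j < n) G j.*2 = \sum_(0 <= j < n.*2) G j.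
  elim: n => [|n IHn]; first by rewrite !big_geq.
  rewrite doubleS !big_nat_recr //= IHn -addrA; congr (_ + _).
  by rewrite [X in _ + X]/G gauss_moment_odd ?mulr0 ?addr0 //= odd_double.
rewrite dbl (@big_cat_nat _ _ _ d.+1 0 d.+1.*2) //=; last by lia.
rewrite [X in _ = _ + X]big_nat_cond [X in _ = _ + X]big1 ?addr0 //.
by move=> j /andP [/andP [dj _] _]; apply: G0.
Qed.

(** * Sums of values of a polynomial *)

(** The summation points of Hausdorff's identity, with multiplicity, translated by [a]. *)
Fixpoint spread (ts : seq rat) (a : rat) (xs : seq rat) : seq rat :=
  if xs is x :: xs' then flatten [seq spread ts (a + x * t) xs' | t <- ts]
  else [:: a].

Lemma size_spread ts a xs : size (spread ts a xs) = (size ts ^ size xs)%N.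
Proof.
elim: xs a => [//|x xs IHxs] a /=.
rewrite size_flatten /shape -map_comp expnS.
rewrite (eq_map (g := fun=> (size ts ^ size xs)%N)); last by move=> t /=.
move: (size ts ^ size xs)%N => k; clear IHxs.
by elim: ts => //= t ts' ->; rewrite mulSn.
Qed.

Lemma mem_spread ts a xs : 0 \in ts -> a \in spread ts a xs.
Proof.
move=> ts0; elim: xs => [|x xs IHxs] /=; first by rewrite inE.
by apply/flatten_mapP; exists 0; rewrite ?mulr0 ?addr0.
Qed.

(** Each [x] applies the heat operator for time [x^2], and the semigroup law adds up the times. *)
Lemma sum_spread d ts (p : {poly rat}) a xs :
  gaussian_nodes d ts -> (size p <= d.+1)%N ->
  \sum_(z <- spread ts a xs) p.[z] =
  (size ts ^ size xs)%:R * (heat d.+1 (\sum_(x <- xs) x ^+ 2) p).[a].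
Proof.
move=> Hts sp; elim: xs a => [|x xs IHxs] a /=.
  by rewrite big_seq1 big_nil mul1r heat0.
rewrite big_flatten big_map big_cons.
under eq_bigr => t _ do rewrite IHxs.
rewrite -mulr_sumr (sum_gaussian_nodes _ _ _ _ _ Hts) ?heatD //.
  by rewrite mulrA -natrM mulnC -expnS.
exact: leq_trans (size_heat _ _ _) sp.
Qed.

Lemma sumsetD (X : rat -> Prop) M N p q :
  sumset X M p -> sumset X N q -> sumset X (M + N) (p + q).
Proof.
move=> [s [<- [sX <-]]] [t [<- [tX <-]]]; exists (s ++ t).
rewrite size_cat big_cat; split=> //; split=> // x.
by rewrite mem_cat => /orP [/sX|/tX].
Qed.

Lemma sumset_poly_image (f : {poly rat}) (zs : seq rat) :
  sumset (poly_image f) (size zs) (\sum_(z <- zs) f.[z]).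
Proof.
exists [seq f.[z] | z <- zs]; rewrite size_map big_map; split=> //; split=> // x.
by case/mapP => z _ ->; exists z.
Qed.

Lemma sumset1 (f : {poly rat}) (z : rat) : sumset (poly_image f) 1 f.[z].
Proof. by have := sumset_poly_image f [:: z]; rewrite big_seq1. Qed.

(* Fixing [y] and writing [r - y^2] as a sum of four squares, the total over all
   the points [y t0 + x1 t1 + ... + x4 t4] depends on [r] only, and [y] is
   one of these points. *)
Lemma sumset_complement (f : {poly rat}) (r : rat) : exists (N : nat) (M : rat),
  forall y, y ^+ 2 <= r -> sumset (poly_image f) N (M - f.[y]).
Proof.
have [ts [ts0 ts1 Hts]] := gauss_quadrature (size f).+1 isT.
(* [M] is the sum over all points; one of them, [y], is taken out. *)
exists (size ts ^ 5).-1, ((size ts ^ 5)%:R * (heat (size f).+2 r f).[0]) => y yr.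
have [a [b [c [e eq_r]]]] : four_squares (r - y ^+ 2).
  by apply: four_squares_ge0; rewrite subr_ge0.
pose xs := [:: y; a; b; c; e]; pose zs := spread ts 0 xs.
(* Choose the node 1 for the coordinate [y] and the node 0 for the others. *)
have yzs : y \in zs.
  apply/flatten_mapP; exists 1 => //; rewrite add0r mulr1.
  exact: (mem_spread ts y [:: a; b; c; e]).
have -> : (size ts ^ 5)%:R * (heat (size f).+2 r f).[0] = \sum_(z <- zs) f.[z].
  have sf : (size f <= (size f).+2)%N by rewrite ltnW.
  have er : \sum_(x <- xs) x ^+ 2 = r.
    by rewrite !big_cons big_nil -[RHS](subrK (y ^+ 2)) eq_r; ring.
  by rewrite (sum_spread _ _ _ 0 xs Hts sf) er.
rewrite (perm_big _ (perm_to_rem yzs)) big_cons addrC addKr.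
rewrite -(size_spread ts 0 xs) -(size_rem yzs).
exact: sumset_poly_image.
Qed.

(** * Iterated differences and an interval of sums *)

Lemma coef_Xadd1_exp (R : nzRingType) n k : (('X + 1%:P) ^+ n : {poly R})`_k = 'C(n, k)%:R.
Proof.
rewrite exprD1n coef_sum.
under eq_bigr => i _ do rewrite coefMn coefXn.
have [kn|nk] := leqP k n; last first.
  rewrite bin_small // big1 // => i _.
  by rewrite gtn_eqF ?mul0rn // (leq_trans (ltn_ord i)).
rewrite (bigD1 (Ordinal (kn : k < n.+1)%N)) //= eqxx big1 ?addr0 // => i.
by rewrite -val_eqE eq_sym /= => /negbTE ->; rewrite mul0rn.
Qed.

(** The difference [f(x + 1) - f(x)] lowers the degree by exactly one; iterate down to degree 1. *)
Lemma signed_shifts_linear (f : {poly rat}) : (1 < size f)%N ->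
  exists (cs ds : seq rat) (alpha beta : rat), alpha != 0 /\ forall x,
  \sum_(c <- cs) f.[x + c] - \sum_(c <- ds) f.[x + c] = alpha * x + beta.
Proof.
have [n] := ubnP (size f); elim: n f => // n IHn f; rewrite ltnS => fn f1.
have [f2|f2] := leqP (size f) 2.
  have sf : size f = 2%N by apply/eqP; rewrite eqn_leq f2.
  exists [:: 0], [::], f`_1, f`_0; split.
    by have := lead_coef_eq0 f; rewrite /lead_coef sf /= -size_poly_eq0 sf => ->.
  move=> x; rewrite big_seq1 big_nil subr0 addr0 horner_coef sf.
  by rewrite !big_ord_recl big_ord0 /=; ring.
pose g := f \Po ('X + 1%:P) - f.
have gE x : g.[x] = f.[x + 1] - f.[x].
  by rewrite hornerD hornerN horner_comp !hornerE.
have sg : size g = (size f).-1.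
  have f0 : (0 < size f)%N by lia.
  have [k [ek k2]] : exists k, size f = k.+2 /\ (0 < k)%N by exists (size f - 2)%N; lia.
  have sle : (size g <= k.+1)%N.
    apply/leq_sizeP => j jk; rewrite coefB.
    have -> : 1%:P = - (- 1)%:P :> {poly rat} by rewrite polyCN opprK.
    have [ej|nj] := eqVneq j k.+1.
      by rewrite coef_comp_shift ?subrr // ek ej.
    by rewrite !nth_default ?subrr ?size_comp_poly2 ?size_XsubC // ek; lia.
  (* The coefficient of [X^k] in [g] is [k.+1] times the leading coefficient of [f], hence not 0. *)
  rewrite ek; apply/eqP; rewrite eqn_leq sle /= ltnNge; apply/negP => sk.
  have : g`_k = 0 by rewrite nth_default.
  rewrite coefB coef_comp_poly ek.
  under eq_bigr => i _ do rewrite coef_Xadd1_exp.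
  rewrite !big_ord_recr /= big1 ?add0r => [|i _].
    rewrite binn binSn mulr1 addrAC subrr add0r => /eqP.
    by rewrite mulf_eq0 pnatr_eq0 orbF; have := lead_coef_eq0 f; rewrite /lead_coef ek /= -size_poly_eq0 ek => ->.
  by rewrite bin_small ?mulr0 // ltn_ord.
have [||cs [ds [al [be [al0 E]]]]] := IHn g.
- by rewrite sg; lia.
- by rewrite sg; lia.
exists ([seq c + 1 | c <- cs] ++ ds), (cs ++ [seq c + 1 | c <- ds]), al, be.
split=> // x; rewrite -E !big_cat !big_map /=.
have gs l : \sum_(c <- l) g.[x + c] = \sum_(c <- l) f.[x + (c + 1)] - \sum_(c <- l) f.[x + c].
  by rewrite -sumrB; apply: eq_bigr => c _; rewrite gE addrA.
by rewrite !gs; ring.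
Qed.

(** With each [- f(x + c)] completed to [M - f(x + c)], the sum stays linear in [x]; for [|x| <= 1]
    it fills an interval of radius [|al|]. *)
Lemma sumset_interval (f : {poly rat}) : (1 < size f)%N ->
  exists (N : nat) (u v : rat), u < v /\
  forall q, u <= q <= v -> sumset (poly_image f) N q.
Proof.
move=> f1; have [cs [ds [al [be [al0 E]]]]] := signed_shifts_linear f f1.
(* A common bound for all [(x + c)^2] with [|x| <= 1]; the sum stands in for a maximum. *)
pose r : rat := \sum_(c <- ds) (1 + `|c|) ^+ 2.
have [N [M HM]] := sumset_complement f r.
pose mid := be + (size ds)%:R * M.
have a0 : 0 < `|al| by rewrite normr_gt0.
exists (size cs + size ds * N)%N, (mid - `|al|), (mid + `|al|); split; first by lra.
move=> q; rewrite -ler_distl => qmid; pose x := (q - mid) / al.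
have x1 : `|x| <= 1 by rewrite normrM normfV ler_pdivrMr ?mul1r.
have -> : q = \sum_(c <- cs) f.[x + c] + \sum_(c <- ds) (M - f.[x + c]).
  rewrite sumrB big_const_seq count_predT iter_addr_0 -mulr_natl.
  by rewrite addrCA E /x /mid; field.
have sq c : c \in ds -> (x + c) ^+ 2 <= r.
  move=> cds; rewrite -real_normK ?num_real // /r (big_rem c) //=.
  apply: (@le_trans _ _ ((1 + `|c|) ^+ 2)); last first.
    by rewrite lerDl sumr_ge0 // => i _; rewrite exprn_ge0 // addr_ge0.
  rewrite lerXn2r ?nnegrE ?addr_ge0 //.
  by apply: le_trans (ler_normD _ _) _; rewrite lerD2r.
apply: sumsetD.
  have := sumset_poly_image f [seq x + c | c <- cs].
  by rewrite size_map big_map.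
have Hds c : c \in ds -> sumset (poly_image f) N (M - f.[x + c]) by move/sq/HM.
elim: (ds) Hds => [|c l IHl] Hl.
  by rewrite big_nil; exists [::]; rewrite big_nil.
rewrite big_cons /= mulSn; apply: sumsetD; first by apply: Hl; rewrite inE eqxx.
by apply: IHl => c' c'l; apply: Hl; rewrite inE c'l orbT.
Qed.

(** * From an interval to all large rationals *)

Lemma poly_unbounded (p : {poly rat}) (c : rat) :
  (1 < size p)%N -> 0 < lead_coef p -> exists2 A, 0 < A & c < p.[A].
Proof.
move=> p1 lp; have [n Hn] := poly_lim_infty (c + 1) lp p1.
exists (Num.max 1 n); first by rewrite lt_max ltr01.
have := Hn (Num.max 1 n); rewrite le_max lexx orbT => /(_ isT); lra.
Qed.

(** Over the rationals the value [c] need not be attained. On a grid so fine that the Lipschitz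
    constant [B] allows jumps of at most [e], the first point with value at least [c] serves. *)
Lemma poly_approx_ivt (p : {poly rat}) (A c e : rat) :
  0 < A -> 0 < e -> p.[0] < c -> c < p.[A] -> exists y, c <= p.[y] <= c + e.
Proof.
move=> A0 e0 p0c cpA; set B := poly_accr_bound p 0 A.
have B0 : 0 < B by apply: poly_accr_bound_gt0.
pose n := (Num.bound (A * B / e)).+1.
have nB : A / n%:R * B <= e.
  rewrite mulrAC ler_pdivrMr ?ltr0n // -ler_pdivrMl // mulrC.
  have AB : 0 <= A * B / e by apply: divr_ge0 (mulr_ge0 (ltW A0) (ltW B0)) (ltW e0).
  by rewrite /n -natr1; have := archi_boundP AB; lra.
pose y (i : nat) : rat := i%:R / n%:R * A.
have yA : y n = A by rewrite /y divff ?mul1r // pnatr_eq0.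
have ex : exists i, (i <= n)%N && (c <= p.[y i]).
  by exists n; rewrite leqnn yA ltW.
case: (ex_minnP ex) => -[|i] /andP [i_n cp] mini.
  by move: cp; rewrite /y mulr0n !mul0r leNgt p0c.
exists (y i.+1); rewrite cp /=.
have lt : p.[y i] < c.
  rewrite ltNge; apply/negP => cpi.
  by have := mini i; rewrite cpi (ltnW i_n) ltnn => /(_ isT).
have yb k : (k <= n)%N -> `|y k - 0| <= A.
  move=> kn; have k0 : 0 <= k%:R / n%:R :> rat by apply: divr_ge0.
  rewrite subr0 ger0_norm; last exact: mulr_ge0 k0 (ltW A0).
  by rewrite ler_piMl ?(ltW A0) // ler_pdivrMr ?ltr0n // mul1r ler_nat.
have := poly_accr_bound1P p (yb i (ltnW i_n)) (yb i.+1 i_n).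
have -> : y i.+1 - y i = A / n%:R.
  by rewrite /y -natr1; field; rewrite pnatr_eq0.
have An0 : 0 <= A / n%:R by apply: divr_ge0 (ltW A0) _.
rewrite (ger0_norm An0) -/B.
by move/(le_trans (ler_norm _)); lra.
Qed.

Lemma positive_base_of_lead_coef_gt0 (f : {poly rat}) :
  (1 < size f)%N -> 0 < lead_coef f -> is_positive_base (poly_image f).
Proof.
move=> f1 lf; have [N [u [v [uv H]]]] := sumset_interval f f1.
(* For [q] beyond this threshold [f.[0] < q - v], so some [f.[y]] lies between [q - v] and [q - u],
   and [q - f.[y]] lies in the interval. *)
exists N.+1, (f.[0] + v); split=> // q qa.
have [A A0 Aq] := poly_unbounded f (q - v) f1 lf.
have [||y /andP [y1 y2]] := poly_approx_ivt f A (q - v) (v - u) A0 _ _ Aq; try lra.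
have -> : q = (q - f.[y]) + f.[y] by ring.
rewrite -addn1; apply: sumsetD (sumset1 _ _).
by apply: H; apply/andP; split; lra.
Qed.

Lemma sumset_opp (f : {poly rat}) N q :
  sumset (poly_image (- f)) N q -> sumset (poly_image f) N (- q).
Proof.
move=> [s [<- [sX <-]]]; exists [seq - x | x <- s].
rewrite size_map big_map sumrN; split=> //; split=> // x /mapP [y ys ->].
by have [a <-] := sX y ys; exists a; rewrite hornerN opprK.
Qed.

Lemma lead_coef_compN (R : idomainType) (f : {poly R}) :
  lead_coef (f \Po (- 'X)) = (-1) ^+ (size f).-1 * lead_coef f.
Proof. by rewrite lead_coef_comp ?size_polyN ?size_polyX // lead_coefN lead_coefX mulrC. Qed.

(** In odd degree [f.[- A]] can be made so negative that [q - f.[- A]] passes the threshold of the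
    positive base. *)
Lemma base_of_odd_lead_coef_gt0 (f : {poly rat}) :
  (1 < size f)%N -> odd (size f).-1 -> 0 < lead_coef f -> WP f.
Proof.
move=> f1 odf lf; have [N [a [N0 H]]] := positive_base_of_lead_coef_gt0 f f1 lf.
exists N.+1; split=> // q.
have [||A _] := poly_unbounded (- (f \Po (- 'X))) (a - q).
- by rewrite size_polyN size_comp_poly2 // size_polyN size_polyX.
- by rewrite lead_coefN lead_coef_compN -signr_odd odf expr1 mulN1r opprK.
rewrite hornerN horner_comp hornerN hornerX => ltA.
have -> : q = (q - f.[- A]) + f.[- A] by ring.
by rewrite -addn1; apply: sumsetD (sumset1 _ _); apply: H; lra.
Qed.

Theorem theorem4p1 (f : {poly rat}) (hf : (1 < size f)%N) :
  (odd (size f).-1 -> WP f) /\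
  (~~ odd (size f).-1 ->
     (0 < lead_coef f -> is_positive_base (poly_image f)) /\
     (lead_coef f < 0 -> is_negative_base (poly_image f))).
Proof.
split=> [odf|_]; last split.
- have [lf|lf] := ltP 0 (lead_coef f); first exact: base_of_odd_lead_coef_gt0.
  have lf0 : lead_coef f < 0.
    by rewrite lt_neqAle lf lead_coef_eq0 -size_poly_gt0 ltnW.
  (* Replacing [x] by [-x] keeps the set of values and, in odd degree, flips the sign of the leading
     coefficient. *)
  have sN : size (f \Po (- 'X)) = size f.
    by rewrite size_comp_poly2 // size_polyN size_polyX.
  have [|||N [N0 H]] := base_of_odd_lead_coef_gt0 (f \Po (- 'X)); rewrite ?sN //.
    by rewrite lead_coef_compN -signr_odd odf expr1 mulN1r oppr_gt0.
  exists N; split=> // q; have [s [ss [sX sq]]] := H q.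
  exists s; split=> //; split=> // x /sX [a <-].
  by exists (- a); rewrite horner_comp hornerN hornerX.
- exact: positive_base_of_lead_coef_gt0.
- move=> lf; have [||N [a [N0 H]]] := positive_base_of_lead_coef_gt0 (- f).
  + by rewrite size_polyN.
  + by rewrite lead_coefN oppr_gt0.
  exists N, (- a); split=> // q qa.
  by rewrite -[q]opprK; apply: sumset_opp; apply: H; lra.
Qed.
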